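(* Let $n\ge 0$ and let $a_0,a_1,\dots,a_n$ be integers such that $$(a_{0}-a_{2}+a_{4}-\dots)^{2}+(a_{1}-a_{3}+a_{5}-\dots)^{2}$$ is a prime number, and such that $|a_{0}|>\sum_{i>0}|a_{i}|\sqrt{2^i}$. Then the polynomial $\sum_{i=0}^{n}a_{i}X^{i}$ is irreducible over $\mathbb{Q}$.
   Context: The alternating sums are $\sum_{i\ge 0}(-1)^i a_{2i}$ and $\sum_{i\ge 0}(-1)^i a_{2i+1}$, with $a_i=0$ for $i>n$. *)

(* Defs.v *)
From mathcomp Require Import all_boot all_order all_algebra.
From mathcomp Require Import reals.

Set Implicit Arguments.
Unset Strict Implicit.
Unset Printing Implicit Defensive.

Import GRing.Theory Num.Theory.

Local Open Scope ring_scope.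

(* For a vanishing beyond index n, the sums over i >= 0 of (-1)^i a_(2i) and
   (-1)^i a_(2i+1); every term with i > n is zero. *)
Definition alt_even (n : nat) (a : nat -> int) : int :=
  \sum_(0 <= i < n.+1) (-1) ^+ i * a (2 * i)%N.

Definition alt_odd (n : nat) (a : nat -> int) : int :=
  \sum_(0 <= i < n.+1) (-1) ^+ i * a ((2 * i).+1)%N.

(* Main.v *)
Require Import Defs.
From mathcomp Require Import all_boot all_order all_algebra.
From mathcomp Require Import reals.
From mathcomp Require Import complex ring zify.

Import Order.TTheory GRing.Theory Num.Theory.
Local Open Scope ring_scope.

(** Write [f] for the polynomial and identify [Z[i]] with its image in the
    complex numbers.  The alternating sums are the real and imaginary parts of
    [f(i)], so the first hypothesis says that [|f(i)|^2] is a prime.  The second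
    one forces every complex root of [f] to have modulus greater than [sqrt 2],
    since on the closed disc of radius [sqrt 2] the constant term outweighs all
    the others together ([dominant_const_root]).

    If [f = g * h] with integer polynomials, then [|g(i)|^2] and [|h(i)|^2] are
    natural numbers whose product is prime, hence one of them is 1.  It remains
    to see that a nonconstant divisor [g] has [|g(i)| > 1]
    ([norm_horner_i_gt1]).  The triangle inequality on [|i - z|] alone is too
    weak, as it only gives [|i - z| > sqrt 2 - 1]; but [g] has real
    coefficients, so [|g(i)|^2 = |g(i) g(-i)|], and each root [z] contributes to
    this product the factor [(i - z) (-i - z) = 1 + z^2], of modulus at least
    [|z|^2 - 1 > 1].  Gauss's lemma passes from rational to integer
    factorizations ([irreducible_of_prime_norm]). *)

Section GaussianValues.

Variable C : numClosedFieldType.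
Implicit Types (P g h : {poly int}) (z : C).

Local Notation toC P := (map_poly (intr : int -> C) P).

Lemma norm_gaussian (u v : int) :
  `|u%:~R + 'i * v%:~R : C| ^+ 2 = (absz (u ^+ 2 + v ^+ 2))%:R.
Proof.
rewrite normC2_rect ?realz // -!rmorphXn -rmorphD /= [RHS]pmulrn abszE.
by rewrite ger0_norm // addr_ge0 ?sqr_ge0.
Qed.

Lemma horner_i_gaussian P :
  exists u v : int, (toC P).['i] = u%:~R + 'i * v%:~R.
Proof.
elim/poly_ind: P => [|P c [u [v Puv]]].
  by exists 0, 0; rewrite rmorph0 horner0 mulr0 addr0.
exists (c - v), u.
rewrite rmorphD rmorphM /= map_polyX map_polyC /= !hornerE Puv rmorphB /=.
by rewrite mulrDl mulrAC -expr2 sqrCi; ring.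
Qed.

Lemma norm_horner_i_nat P : exists m : nat, `|(toC P).['i]| ^+ 2 = m%:R.
Proof.
have [u [v ->]] := horner_i_gaussian P.
by exists (absz (u ^+ 2 + v ^+ 2)); exact: norm_gaussian.
Qed.

Lemma norm_horner_conj P : `|(toC P).[- 'i]| = `|(toC P).['i]|.
Proof.
rewrite -[RHS]norm_conjC -horner_map /= conjCi -map_poly_comp.
by congr (`|_.[_]|); apply: eq_map_poly => c /=; rewrite rmorph_int.
Qed.

(** Pairing the values at ['i] and [- 'i] turns the factor of a root [z] into
    [1 + z^2], which is large although ['i - z] itself may be small. *)
Lemma norm_horner_i_gt1 P :
    (1 < size P)%N -> (forall z, root (toC P) z -> 2 < `|z| ^+ 2) ->
  1 < `|(toC P).['i]| ^+ 2.
Proof.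
move=> sP rootsP.
have [rs Prs] := closed_field_poly_normal (toC P).
have lcE : lead_coef (toC P) = (lead_coef P)%:~R.
  by rewrite lead_coef_map_inj //; exact: intr_inj.
have P0 : P != 0 by rewrite -size_poly_gt0 ltnW.
have lc0 : lead_coef P != 0 by rewrite lead_coef_eq0.
have lc1 : 1 <= `|lead_coef (toC P)| ^+ 2.
  by rewrite exprn_ege1 // lcE -intr_norm ler1z -gtz0_ge1 normr_gt0.
have rs_big z : z \in rs -> 2 < `|z| ^+ 2.
  move=> zrs; apply: rootsP; rewrite Prs rootZ ?root_prod_XsubC //.
  by rewrite lcE intr_eq0.
have rs_nnil : (0 < size rs)%N.
  have := size_map_inj_poly (@intr_inj C) (rmorph0 _) P.
  rewrite Prs size_scale ?size_prod_XsubC; last by rewrite lcE intr_eq0.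
  by move=> [sE]; rewrite -ltnS sE.
have -> : `|(toC P).['i]| ^+ 2
    = `|lead_coef (toC P)| ^+ 2 * \prod_(z <- rs) `|1 + z ^+ 2|.
  rewrite expr2 -{2}norm_horner_conj -normrM Prs !hornerZ !horner_prod.
  rewrite mulrACA -big_split /= normrM normr_prod -expr2 normrX -Prs.
  congr (_ * _); apply: eq_bigr => z _; congr `|_|.
  rewrite !hornerXsubC; have := sqrCi C; move: ('i : C) => j jj.
  by rewrite -[1]opprK -jj; ring.
have fac_gt1 z : z \in rs -> 1 < `|1 + z ^+ 2|.
  move=> /rs_big z2.
  have : `|z ^+ 2| - `|1 : C| <= `|1 + z ^+ 2|.
    by rewrite [1 + _]addrC; apply: lerB_normD.
  rewrite normr1 normrX; apply: lt_le_trans.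
  by rewrite ltrBrDr.
apply: lt_le_trans (_ : \prod_(z <- rs) `|1 + z ^+ 2| <= _); last first.
  by rewrite ler_peMl // prodr_ge0.
case: rs rs_nnil fac_gt1 {Prs rs_big} => // z rs _ fac_gt1.
rewrite big_cons.
apply: lt_le_trans (fac_gt1 z (mem_head _ _)) _.
rewrite ler_peMr // big_seq.
elim/big_ind: _ => // [x y x1 y1|y yrs]; first by rewrite mulr_ege1.
by rewrite ltW // fac_gt1 // inE yrs orbT.
Qed.

(** Of two integer factors with prime product of squared norms at ['i], one has
    squared norm 1, hence is constant by [norm_horner_i_gt1]; over [rat] such a
    factorization is trivial, even if the constant is not a unit of [int]. *)
Lemma irreducible_of_prime_norm P (p : nat) :
    prime p -> `|(toC P).['i]| ^+ 2 = p%:R ->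
    (forall z, root (toC P) z -> 2 < `|z| ^+ 2) ->
  irreducible_poly (map_poly intr P : {poly rat}).
Proof.
move=> p_pr Pp rootsP.
have size_rat g : size (map_poly intr g : {poly rat}) = size g.
  by apply: size_map_inj_poly; [exact: intr_inj|].
have P0 : P != 0.
  apply: contraTneq p_pr => P0; move: Pp.
  rewrite P0 rmorph0 horner0 normr0 expr0n /= => /esym/eqP.
  by rewrite pnatr_eq0 => /eqP->.
split=> [|q sq qP].
  rewrite size_rat ltnNge; apply/negP => /size1_polyC Pc; move: Pp.
  (* The value of a constant is an integer, whose square is not a prime. *)
  rewrite Pc map_polyC hornerC /= -intr_norm -abszE -pmulrn -natrX.
  move=> /(mulrIn (oner_neq0 C)) cp.
  have /primeP[] := p_pr; rewrite -cp expnS expn1 => c_gt1.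
  by move=> /(_ _ (dvdn_mulr _ (dvdnn _))); nia.
have [g [c c0 qE] [h PE]] := dvdpP_rat_int qP.
have [m gm] := norm_horner_i_nat g.
have [k hk] := norm_horner_i_nat h.
have mkp : (m * k)%N = p.
  apply: (mulrIn (oner_neq0 C)); rewrite natrM -gm -hk -Pp PE rmorphM /=.
  by rewrite hornerM normrM exprMn.
have sqg : size q = size g by rewrite qE size_scale // size_rat.
have [g0 h0] : g != 0 /\ h != 0.
  by apply/andP; rewrite -negb_or -mulf_eq0 -PE.
have rootsg z : root (toC g) z -> 2 < `|z| ^+ 2.
  by move=> zg; apply: rootsP; rewrite PE rmorphM rootM zg.
have rootsh z : root (toC h) z -> 2 < `|z| ^+ 2.
  by move=> zh; apply: rootsP; rewrite PE rmorphM rootM zh orbT.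
have m1 : (1 < m)%N.
  rewrite -(ltr_nat C) -gm norm_horner_i_gt1 //.
  by rewrite ltn_neqAle eq_sym -sqg sq sqg size_poly_gt0.
have k1 : (k <= 1)%N.
  rewrite leqNgt; apply/negP => k1.
  have /primeP[_ /(_ m)] := p_pr.
  rewrite -mkp dvdn_mulr // => /(_ isT); nia.
have sh : size h = 1%N.
  apply/eqP; rewrite eqn_leq size_poly_gt0 h0 andbT leqNgt; apply/negP => sh.
  by have := norm_horner_i_gt1 _ sh rootsh; rewrite hk (ltr_nat C 1) ltnNge k1.
rewrite -(dvdp_size_eqp qP) size_rat sqg PE size_mul //.
by rewrite sh addn1.
Qed.

(** At a root, the constant term is the opposite of the sum of the others, which
    is too small for that when [`|z| <= t]. *)
Lemma dominant_const_root n (a : nat -> int) (t z : C) :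
    0 <= t ->
    \sum_(1 <= i < n.+1) `|a i|%:~R * t ^+ i < `|a 0%N|%:~R ->
    root (\sum_(0 <= i < n.+1) (a i)%:~R *: 'X^i) z ->
  t < `|z|.
Proof.
move=> t0 a0_large /rootP; rewrite horner_sum big_nat_recl // => fz.
rewrite real_ltNge ?ger0_real //; apply/negP => zt.
move: a0_large; apply/negP; rewrite -real_leNgt ?realz //; last first.
  apply/ger0_real/sumr_ge0 => i _.
  by rewrite mulr_ge0 ?exprn_ge0 // ler0z.
move: fz; rewrite hornerZ expr0 hornerC mulr1 => /eqP.
rewrite addr_eq0 => /eqP a0E.
rewrite intr_norm a0E normrN big_add1 /=.
apply: le_trans (ler_norm_sum _ _ _) _; apply: ler_sum => i _.
rewrite hornerZ hornerXn normrM normrX intr_norm.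
by rewrite ler_wpM2l // lerXn2r // ?nnegrE.
Qed.

Lemma sum_nat_double (V : nmodType) (F : nat -> V) m :
  \sum_(0 <= i < m.*2) F i = \sum_(0 <= i < m) (F (2 * i)%N + F (2 * i).+1).
Proof.
elim: m => [|m IHm]; first by rewrite !big_geq.
by rewrite doubleS !big_nat_recr //= IHm mul2n addrA.
Qed.

Lemma horner_i_alt n (a : nat -> int) :
    (forall i : nat, (n < i)%N -> a i = 0) ->
  (\sum_(0 <= i < n.+1) (a i)%:~R *: 'X^i).['i : C]
    = (alt_even n a)%:~R + 'i * (alt_odd n a)%:~R.
Proof.
move=> a_eq0; rewrite horner_sum.
under eq_bigr do rewrite hornerZ hornerXn.
pose F i : C := (a i)%:~R * 'i ^+ i.
have -> : \sum_(0 <= i < n.+1) F i = \sum_(0 <= i < n.+1.*2) F i.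
  rewrite [RHS](@big_cat_nat _ _ _ n.+1) //=; last by lia.
  rewrite [X in _ + X]big_nat_cond [X in _ + X]big1 ?addr0 // => i.
  by rewrite andbT => /andP[ni _]; rewrite /F a_eq0 // mul0r.
rewrite sum_nat_double big_split /= /alt_even /alt_odd !rmorph_sum mulr_sumr.
by congr (_ + _); apply: eq_bigr => i _;
  rewrite /F ?exprS exprM sqrCi rmorphM rmorphXn rmorphN1 /=; ring.
Qed.

End GaussianValues.

Theorem theoremB (R : realType) (n : nat) (a : nat -> int)
  (a_eq0 : forall i : nat, (n < i)%N -> a i = 0)
  (prime_alt : prime (absz (alt_even n a ^+ 2 + alt_odd n a ^+ 2)))
  (a0_large :
    \sum_(1 <= i < n.+1) `|a i|%:~R * Num.sqrt ((2 : R) ^+ i)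
      < `|a 0%N|%:~R :> R) :
  irreducible_poly (\sum_(0 <= i < n.+1) (a i)%:~R *: 'X^i : {poly rat}).
Proof.
have mapE (K : fieldType) : map_poly (intr : int -> K)
    (\sum_(0 <= i < n.+1) a i *: 'X^i) = \sum_(0 <= i < n.+1) (a i)%:~R *: 'X^i.
  by rewrite rmorph_sum; apply: eq_bigr => i _ /=; rewrite map_polyZ map_polyXn.
rewrite -mapE; apply: (@irreducible_of_prime_norm R[i] _ _ prime_alt).
  by rewrite mapE horner_i_alt // norm_gaussian.
move=> z; rewrite mapE.
pose t : R[i] := (Num.sqrt 2)%:C%C.
have t0 : 0 <= t by rewrite lecR sqrtr_ge0.
have t2 : t ^+ 2 = 2 by rewrite -rmorphXn /= sqr_sqrtr ?ler0n // rmorph_nat.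
move=> /(dominant_const_root _ _ _ _ _ t0) zt.
rewrite -t2 ltrXn2r // ?nnegrE ?normr_ge0 //; apply: zt.
move: a0_large; rewrite -ltcR rmorph_sum rmorph_int /=.
congr (_ < _); apply: eq_bigr => i _.
have -> : Num.sqrt ((2 : R) ^+ i) = Num.sqrt 2 ^+ i.
  rewrite -{1}[2 : R]sqr_sqrtr ?ler0n // exprAC sqrtr_sqr ger0_norm //.
  by rewrite exprn_ge0 // sqrtr_ge0.
by rewrite rmorphM rmorph_int rmorphXn.
Qed.
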